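(* For $n\ge0$, $$h_n(x,y;q)=(-1)^n\sum_{k=0}^n\begin{bmatrix}n\\k\end{bmatrix}_q h_k(x/a,0;q)\,(-a)^k\,p_{n-k}(y,a;q).$$
   Context: $q$ is a fixed number with $0<|q|<1$ and $a\ne0$. $(z;p)_n=\prod_{i=0}^{n-1}(1-zp^i)$, $(z;p)_\infty=\prod_{i\ge0}(1-zp^i)$, $(z)_n=(z;q)_n$ for $n$ finite or $\infty$, and $\begin{bmatrix}n\\k\end{bmatrix}_q=\frac{(q)_n}{(q)_k(q)_{n-k}}$. The discrete big $q$-Hermite I polynomials $h_n(x,y;q)$ are defined by the formal power series identity in $t$ $$\sum_{n=0}^\infty h_n(x,y;q)\frac{t^n}{(q;q)_n}=\frac{(t^2;q^2)_\infty(yt)_\infty}{(xt)_\infty}.$$ For integers $t\ge0$, $$p_t(y,a;q)=\sum_{m=0}^{\lfloor t/2\rfloor}\begin{bmatrix}t\\2m\end{bmatrix}_q(q;q^2)_m\,a^{2m}(1/a^2;q^2)_m\,y^{t-2m}q^{\binom{t-2m}{2}}.$$ *)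

(* Defs.v *)
From HB Require Import structures.
From mathcomp Require Import all_boot all_order all_algebra.
From mathcomp Require Import complex.
From mathcomp Require Import all_classical all_reals all_analysis.

Set Implicit Arguments.
Unset Strict Implicit.
Unset Printing Implicit Defensive.

Import Order.TTheory GRing.Theory Num.Theory.
Import numFieldNormedType.Exports.

Local Open Scope classical_set_scope.
Local Open Scope ring_scope.

(* (z;p)_n; used both for scalars and, with A := {poly K}, for polynomials in
   the formal variable t = 'X. *)
Definition qpoch (A : comNzRingType) (z p : A) (n : nat) : A :=
  \prod_(i < n) (1 - z * p ^+ i).

Definition qbinom (K : fieldType) (q : K) (n k : nat) : K :=
  qpoch q q n / (qpoch q q k * qpoch q q (n - k)).

(* A formal power series sum_n f_n t^n is its coefficient sequence
   f : nat -> K. *)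
Definition fps_mul (K : fieldType) (f g : nat -> K) : nat -> K :=
  fun n => \sum_(i < n.+1) f i * g (n - i)%N.

(* First n coefficients of 1/f, obtained by solving f * g = 1 degree by
   degree; meaningful when f 0 != 0 (see fps_mulV). *)
Fixpoint fps_inv_seq (K : fieldType) (f : nat -> K) (n : nat) : seq K :=
  if n is m.+1 then
    let s := fps_inv_seq f m in
    rcons s ((f 0%N)^-1 *
             ((m == 0%N)%:R - \sum_(i < m) f i.+1 * s`_(m - i.+1)))
  else [::].

Definition fps_inv (K : fieldType) (f : nat -> K) : nat -> K :=
  fun n => (fps_inv_seq f n.+1)`_n.

Definition fps_div (K : fieldType) (f g : nat -> K) : nat -> K :=
  fps_mul f (fps_inv g).

(* (z;p)_oo as a formal power series in t, for z a polynomial in t and p a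
   scalar: the coefficientwise limit of the partial products (z;p)_N. *)
Definition fps_qpoch_oo (K : numFieldType) (z : {poly K}) (p : K) : nat -> K :=
  fun n => lim ((fun N : nat => (qpoch z p%:P N)`_n) @ \oo).

(* (t^2;q^2)_oo (yt;q)_oo / (xt;q)_oo *)
Definition dqHermite_gf (K : numFieldType) (q x y : K) : nat -> K :=
  fps_div (fps_mul (fps_qpoch_oo 'X^2 (q ^+ 2)) (fps_qpoch_oo (y *: 'X) q))
          (fps_qpoch_oo (x *: 'X) q).

(* h_n(x,y;q), read off from
   sum_n h_n(x,y;q) t^n / (q;q)_n = dqHermite_gf q x y (see dqHermiteE). *)
Definition dqHermite (K : numFieldType) (q : K) (n : nat) (x y : K) : K :=
  qpoch q q n * dqHermite_gf q x y n.

Definition pcoef (K : fieldType) (q : K) (t : nat) (y a : K) : K :=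
  \sum_(m < t./2.+1)
    qbinom q t m.*2 * qpoch q (q ^+ 2) m * a ^+ m.*2
    * qpoch (1 / a ^+ 2) (q ^+ 2) m
    * y ^+ (t - m.*2) * q ^+ 'C(t - m.*2, 2).

Lemma size_fps_inv_seq (K : fieldType) (f : nat -> K) n :
  size (fps_inv_seq f n) = n.
Proof. by elim: n => //= n IHn; rewrite size_rcons IHn. Qed.

Lemma nth_fps_inv_seq (K : fieldType) (f : nat -> K) n i :
  (i < n)%N -> (fps_inv_seq f n)`_i = fps_inv f i.
Proof.
elim: n => // n IHn; rewrite ltnS leq_eqVlt => /orP[/eqP -> //|lt_in].
by rewrite /= nth_rcons size_fps_inv_seq lt_in IHn.
Qed.

Lemma fps_invE (K : fieldType) (f : nat -> K) n :
  fps_inv f n = (f 0%N)^-1 *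
    ((n == 0%N)%:R - \sum_(i < n) f i.+1 * fps_inv f (n - i.+1)).
Proof.
rewrite {1}/fps_inv /= nth_rcons size_fps_inv_seq ltnn eqxx.
congr (_ * (_ - _)); apply: eq_bigr => i _.
by rewrite nth_fps_inv_seq // ltn_subrL /=; case: n i => [[]|].
Qed.

Lemma fps_mulV (K : fieldType) (f : nat -> K) n :
  f 0%N != 0 -> fps_mul f (fps_inv f) n = (n == 0%N)%:R.
Proof.
move=> f0; rewrite /fps_mul big_ord_recl subn0 (fps_invE f n) mulVKf //.
by rewrite subrK.
Qed.

Lemma qpoch_neq0 (K : numFieldType) (q : K) n : `|q| < 1 -> qpoch q q n != 0.
Proof.
move=> q1; apply/prodf_neq0 => i _; rewrite -exprS subr_eq0.
apply/eqP => /(congr1 Num.norm); rewrite normr1 normrX => /esym/eqP.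
by rewrite lt_eqF // exprn_ilt1.
Qed.

Lemma dqHermiteE (K : numFieldType) (q x y : K) n :
  `|q| < 1 -> dqHermite q n x y / qpoch q q n = dqHermite_gf q x y n.
Proof. by move=> q1; rewrite /dqHermite mulrC mulKf // qpoch_neq0. Qed.

(* Main.v *)
Require Import Defs.
From mathcomp Require Import all_boot all_order all_algebra.
From mathcomp Require Import complex.
From mathcomp Require Import all_classical all_reals all_analysis.
From mathcomp Require Import ring.
Import Order.TTheory GRing.Theory Num.Theory.
Local Open Scope ring_scope.

(** The identity is a factorization of generating functions. With
    T(c) = (c t^2; q^2)_oo and E(c) = (c t; q)_oo, the series of
    h_n(x, y) / (q)_n is T(1) E(y) / E(x). Substituting t := a t in the series
    of h_n(x/a, 0) / (q)_n gives T(a^2) / E(x), since the x/a is rescaled to x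
    and E(0) = 1. The quotient of the two is therefore
    (T(1) / T(a^2)) E(y), and it remains to see that its coefficients are
    (-1)^n p_n(y, a) / (q)_n: the product of both factors is then exactly the
    convolution on the right-hand side, after multiplication by (q)_n.

    By the q-binomial theorem in base q^2,
    (t^2; q^2)_oo / (a^2 t^2; q^2)_oo is the sum of
    (1/a^2; q^2)_m (a t)^(2m) / (q^2; q^2)_m; by Euler's identity, E(y) is the
    sum of (-y)^i q^(i choose 2) t^i / (q)_i. Their product has the announced
    coefficients because (q)_(2m) = (q; q^2)_m (q^2; q^2)_m
    ([pcoef_generating_function]).

    The only analysis is in Euler's identity ([fps_qpoch_oo_linear]): the
    coefficients of the partial products are explicit by the finite q-binomial
    formula ([coef_qpochX]), and each is the limiting coefficient times a fixed
    number of factors that tend to 1. The q-binomial theorem is then used in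
    the form [q_binomial], where (t; p)_oo stands on the other side of the
    equation; that is a purely formal identity. *)

(** * Formal power series as coefficient sequences *)

Definition fps_one {K : fieldType} : nat -> K := fun n => (n == 0%N)%:R.

(** Truncations turn the convolution into a polynomial product, from which the
    ring laws are inherited. *)
Lemma fps_mul_poly {K : fieldType} {f g : nat -> K} {N n : nat} : (n < N)%N ->
  fps_mul f g n = (\poly_(i < N) f i * \poly_(i < N) g i)`_n.
Proof.
move=> ltnN; rewrite coefM; apply: eq_bigr => i _; rewrite !coef_poly.
by rewrite !ifT // (leq_ltn_trans _ ltnN) ?leq_subr // -ltnS.
Qed.

Lemma fps_mulC {K : fieldType} (f g : nat -> K) : fps_mul f g = fps_mul g f.
Proof. by apply/funext => n; rewrite !(fps_mul_poly (ltnSn n)) mulrC. Qed.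

Lemma fps_mulA {K : fieldType} (f g h : nat -> K) :
  fps_mul f (fps_mul g h) = fps_mul (fps_mul f g) h.
Proof.
apply/funext => n.
pose P u := \poly_(i < n.+1) (u i : K).
transitivity ((P f * (P g * P h))`_n); last rewrite mulrA.
- rewrite coefM; apply: eq_bigr => i _; rewrite coef_poly ltn_ord.
  by rewrite (fps_mul_poly (N := n.+1)) // ltnS leq_subr.
- rewrite coefM; apply: eq_bigr => i _; rewrite [(P h)`_ _]coef_poly.
  by rewrite ltnS leq_subr (fps_mul_poly (ltn_ord i)).
Qed.

Lemma fps_mul1 {K : fieldType} (f : nat -> K) : fps_mul f fps_one = f.
Proof.
apply/funext => n; rewrite /fps_mul big_ord_recr /= subnn mulr1 big1 ?add0r //.
by move=> i _; rewrite /fps_one subn_eq0 leqNgt ltn_ord mulr0.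
Qed.

Lemma fps_inv_uniq {K : fieldType} (f g : nat -> K) :
  f 0%N != 0 -> fps_mul f g = fps_one -> g = fps_inv f.
Proof.
move=> f0 fg1; have fV : fps_mul f (fps_inv f) = fps_one.
  by apply/funext => n; rewrite fps_mulV.
by rewrite -[g]fps_mul1 -fV fps_mulA [fps_mul g f]fps_mulC fg1 fps_mulC fps_mul1.
Qed.

(** The substitution t := a t. *)
Definition fps_dilate {K : fieldType} (a : K) (f : nat -> K) : nat -> K :=
  fun n => a ^+ n * f n.

Lemma fps_dilateM {K : fieldType} (a : K) (f g : nat -> K) :
  fps_dilate a (fps_mul f g) = fps_mul (fps_dilate a f) (fps_dilate a g).
Proof.
apply/funext => n; rewrite /fps_dilate /fps_mul big_distrr /=.
apply: eq_bigr => i _; have lein : (i <= n)%N by rewrite -ltnS.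
by rewrite -{1}(subnKC lein) exprD mulrACA.
Qed.

Lemma fps_dilate1 {K : fieldType} (a : K) : fps_dilate a fps_one = fps_one.
Proof.
by apply/funext => -[|n]; rewrite /fps_dilate /fps_one ?mulr1 ?mulr0.
Qed.

Lemma fps_dilateV {K : fieldType} (a : K) (f : nat -> K) :
  f 0%N != 0 -> fps_dilate a (fps_inv f) = fps_inv (fps_dilate a f).
Proof.
move=> f0; apply: fps_inv_uniq; first by rewrite /fps_dilate mul1r.
rewrite -fps_dilateM -(fps_dilate1 a); congr fps_dilate.
by apply/funext => n; rewrite fps_mulV.
Qed.

(** The substitution t := t^2. *)
Definition fps_even {K : fieldType} (f : nat -> K) : nat -> K :=
  fun n => if odd n then 0 else f n./2.

Lemma sum_even {K : fieldType} (F : nat -> K) (n : nat) :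
  \sum_(i < n.+1) (if odd i then 0 else F i) = \sum_(m < n./2.+1) F m.*2.
Proof.
elim: n => [|n IHn]; first by rewrite !big_ord1.
rewrite big_ord_recr /= IHn uphalf_half.
case: (boolP (odd n)) => odd_n; last by rewrite addr0.
by rewrite add1n [RHS]big_ord_recr /= -[n in F n.+1]odd_double_half odd_n.
Qed.

Lemma fps_mul_even {K : fieldType} (f g : nat -> K) (n : nat) :
  fps_mul (fps_even f) g n = \sum_(m < n./2.+1) f m * g (n - m.*2)%N.
Proof.
transitivity (\sum_(i < n.+1) (if odd i then 0 else f i./2 * g (n - i)%N)).
  by apply: eq_bigr => i _; rewrite /fps_even; case: ifP; rewrite ?mul0r.
rewrite (sum_even (fun i => f i./2 * g (n - i)%N)).
by apply: eq_bigr => m _; rewrite doubleK.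
Qed.

Lemma fps_evenM {K : fieldType} (f g : nat -> K) :
  fps_even (fps_mul f g) = fps_mul (fps_even f) (fps_even g).
Proof.
apply/funext => n; rewrite fps_mul_even {1}/fps_even; case: ifP => odd_n.
  rewrite big1 // => m _; rewrite /fps_even oddB ?odd_n ?odd_double ?mulr0 //.
  by rewrite -geq_half_double -ltnS.
apply: eq_bigr => m _; have mn : (m.*2 <= n)%N.
  by rewrite -geq_half_double -ltnS.
rewrite /fps_even oddB // odd_n odd_double /=; congr (_ * g _).
move: (nat_of_ord m) => k; rewrite -[in RHS](even_halfK (negbT odd_n)).
by rewrite -doubleB doubleK.
Qed.

Lemma fps_dilate_even {K : fieldType} (a : K) (f : nat -> K) :
  fps_dilate a (fps_even f) = fps_even (fps_dilate (a ^+ 2) f).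
Proof.
apply/funext => n; rewrite /fps_dilate /fps_even.
case: (boolP (odd n)) => odd_n; first by rewrite mulr0.
by rewrite -exprM mul2n even_halfK.
Qed.

(** * Euler's identity and the q-binomial theorem, coefficientwise *)

Lemma qpochS {A : comNzRingType} (z p : A) (n : nat) :
  qpoch z p n.+1 = qpoch z p n * (1 - z * p ^+ n).
Proof. by rewrite /qpoch big_ord_recr. Qed.

Lemma qpoch0 {A : comNzRingType} (z p : A) : qpoch z p 0 = 1.
Proof. by rewrite /qpoch big_ord0. Qed.

(** Euler's expansion of (c t; p)_oo; see [fps_qpoch_oo_linear]. *)
Definition euler_series {K : fieldType} (c p : K) : nat -> K :=
  fun k => (- c) ^+ k * p ^+ 'C(k, 2) / qpoch p p k.

(** The q-binomial expansion of (b t; p)_oo / (t; p)_oo; see [q_binomial]. *)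
Definition binomial_series {K : fieldType} (b p : K) : nat -> K :=
  fun k => qpoch b p k / qpoch p p k.

Lemma fps_dilate_euler {K : fieldType} (a c p : K) :
  fps_dilate a (euler_series c p) = euler_series (a * c) p.
Proof.
by apply/funext => n; rewrite /fps_dilate /euler_series -mulrN exprMn !mulrA.
Qed.

Lemma euler_series0 {K : fieldType} (p : K) : euler_series 0 p = fps_one.
Proof.
apply/funext => -[|n]; rewrite /euler_series /fps_one /=.
  by rewrite qpoch0 invr1 mulr1 !expr0 mulr1.
by rewrite oppr0 exprS !mul0r.
Qed.

Lemma qpoch_factor_neq0 {K : fieldType} (p : K) (n : nat) :
  (forall n, qpoch p p n != 0) -> 1 - p ^+ n.+1 != 0.
Proof.
by move=> /(_ n.+1); rewrite qpochS mulf_eq0 negb_or -exprS => /andP[].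
Qed.

(** The finite q-binomial formula, arranged so that the coefficient of the
    infinite product is split off: (p; p)_N / (p; p)_(N - k) appears as the
    product of the 1 - p^(N - i). Since N - i is truncated at 0, that product
    vanishes when k > N, as the coefficient must. *)
Lemma coef_qpochX {K : fieldType} (c p : K) (N k : nat) :
  (forall n, qpoch p p n != 0) ->
  (qpoch (c *: 'X) p%:P N)`_k =
  euler_series c p k * \prod_(i < k) (1 - p ^+ (N - i)).
Proof.
move=> p_neq0; have factor_neq0 n := qpoch_factor_neq0 p n p_neq0.
elim: N k => [|N IHN] [|k].
- by rewrite /euler_series !qpoch0 coef1 big_ord0 invr1 !mulr1.
- by rewrite qpoch0 coef1 big_ord_recl subrr mul0r mulr0.
- rewrite qpochS mulrBr mulr1 coefB IHN -polyC_exp -scalerAl -scalerAr.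
  rewrite coefZ mulrA coefMC coefMX mul0r mulr0 subr0.
  by rewrite /euler_series !big_ord0.
rewrite qpochS mulrBr mulr1 coefB -polyC_exp -scalerAl -scalerAr.
rewrite coefZ mulrA coefMC coefMX /= !IHN [in RHS]big_ord_recl /=.
rewrite [in LHS]big_ord_recr /= /euler_series binS bin1 qpochS -exprS.
rewrite (exprS (- c)) exprD (eq_bigr (fun i : 'I_k => 1 - p ^+ (N - i))) //.
(* For k > N the factor at i = N annihilates both sides. *)
have [lekN|ltNk] := leqP k N.
  have pN : p ^+ N = p ^+ (N - k) * p ^+ k by rewrite -exprD subnK.
  have := factor_neq0 k; rewrite subn0 (exprS p N) pN (exprS p k) => pk_neq0.
  by field; rewrite p_neq0 pk_neq0.
have -> : \prod_(i < k) (1 - p ^+ (N - i)) = 0.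
  by rewrite (bigD1 (Ordinal ltNk)) //= subnn subrr mul0r.
by rewrite !(mulr0, mul0r) subr0.
Qed.

(** The q-binomial theorem cleared of denominators:
    (t; p)_oo * sum_m (b; p)_m t^m / (p; p)_m = (b t; p)_oo. Let F be the
    left-hand side, a product of series e and u. The functional equations
    e(t) = (1 - t) e(p t) and (1 - t) u(t) = (1 - b t) u(p t) give
    F(t) = (1 - b t) F(p t), which is the first-order recurrence that determines
    the coefficients of (b t; p)_oo. *)
Lemma q_binomial {K : fieldType} (b p : K) : (forall n, qpoch p p n != 0) ->
  fps_mul (euler_series 1 p) (binomial_series b p) = euler_series b p.
Proof.
move=> p_neq0; have factor_neq0 n := qpoch_factor_neq0 p n p_neq0.
pose e := euler_series 1 p; pose u := binomial_series b p.
have eS j : e j.+1 * (1 - p ^+ j.+1) = - (p ^+ j * e j).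
  rewrite /e /euler_series qpochS -exprS binS bin1 exprD exprS.
  by field; rewrite p_neq0 factor_neq0.
have uS m : u m.+1 * (1 - p ^+ m.+1) = u m * (1 - b * p ^+ m).
  rewrite /u /binomial_series !qpochS -exprS.
  by field; rewrite p_neq0 factor_neq0.
apply/funext; elim=> [|n IHn].
  rewrite /fps_mul big_ord1 /euler_series /binomial_series !qpoch0 invr1.
  by rewrite !expr0 !mulr1.
apply: (mulIf (factor_neq0 n)).
transitivity (- b * p ^+ n * fps_mul e u n); last first.
  rewrite [fps_mul e u n]IHn /euler_series qpochS -exprS binS bin1 exprD exprS.
  by field; rewrite p_neq0 factor_neq0.
(* Split 1 - p^(n+1) as (1 - p^j) + p^j (1 - p^(n+1-j)), so that each part
   feeds the recurrence of one of the two series. *)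
transitivity (\sum_(j < n.+2) e j * (1 - p ^+ j) * u (n.+1 - j)%N
  + \sum_(j < n.+2) p ^+ j * e j * (u (n.+1 - j)%N * (1 - p ^+ (n.+1 - j)))).
  rewrite /fps_mul big_distrl -big_split /=; apply: eq_bigr => j _.
  rewrite -/e -/u.
  have jn : (j <= n.+1)%N by rewrite -ltnS.
  have -> : p ^+ n.+1 = p ^+ j * p ^+ (n.+1 - j) by rewrite -exprD subnKC.
  by ring.
(* The extreme terms vanish; after a shift of the first sum both sums range
   over the same pairs of total degree n. *)
rewrite big_ord_recl expr0 subrr mulr0 mul0r add0r.
rewrite [X in _ + X]big_ord_recr /= subnn expr0 subrr !mulr0 addr0.
rewrite -big_split big_distrr /=; apply: eq_bigr => j _.
have jn : (j <= n)%N by rewrite -ltnS.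
rewrite /bump add1n subSS eS subSn // uS.
have -> : p ^+ n = p ^+ j * p ^+ (n - j) by rewrite -exprD subnKC.
by ring.
Qed.

Lemma qpoch_double {K : fieldType} (q : K) (m : nat) :
  qpoch q q m.*2 = qpoch q (q ^+ 2) m * qpoch (q ^+ 2) (q ^+ 2) m.
Proof.
elim: m => [|m IHm]; first by rewrite !qpoch0 mulr1.
rewrite doubleS !qpochS IHm -!exprM mul2n -!exprS -exprD add2n; ring.
Qed.

(** In the m-th term of p_t, the factor (q; q^2)_m cancels half of (q)_(2m) in
    the q-binomial coefficient and leaves (q^2; q^2)_m, so that the even and the
    y-dependent parts separate into a convolution. *)
Lemma pcoef_generating_function {K : fieldType} (q y a : K) (t : nat) :
  (forall n, qpoch q q n != 0) ->
  (-1) ^+ t * pcoef q t y a / qpoch q q t =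
  fps_mul
    (fps_even (fps_dilate (a ^+ 2) (binomial_series (1 / a ^+ 2) (q ^+ 2))))
    (euler_series y q) t.
Proof.
move=> q_neq0; rewrite fps_mul_even /pcoef mulr_sumr mulr_suml.
apply: eq_bigr => m _; have mt : (m.*2 <= t)%N.
  by rewrite -geq_half_double -ltnS.
have := q_neq0 m.*2; rewrite /qbinom qpoch_double mulf_eq0 negb_or.
case/andP=> odd_neq0 even_neq0.
rewrite /fps_dilate /binomial_series /euler_series.
rewrite -{1}(subnKC mt) exprD -mul2n exprM sqrrN !expr1n.
rewrite exprM [(- y) ^+ _]exprNn.
by field; rewrite !q_neq0 odd_neq0 even_neq0.
Qed.

(** * Infinite products as coefficientwise limits *)

Local Open Scope classical_set_scope.
Import numFieldNormedType.Exports.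

(** The convergence of p^n to 0 is a separate hypothesis because it does not
    follow from |p| < 1 over a non-archimedean field. *)
Lemma cvg_coef_qpochX {K : numFieldType} (c p : K) (k : nat) :
  `|p| < 1 -> p ^+ n @[n --> \oo] --> (0 : K) ->
  (qpoch (c *: 'X) p%:P N)`_k @[N --> \oo] --> euler_series c p k.
Proof.
move=> p1 cvg_p; have p_neq0 n := qpoch_neq0 n p1.
have -> : (fun N => (qpoch (c *: 'X) p%:P N)`_k) =
    (fun N => euler_series c p k * \prod_(i < k) (1 - p ^+ (N - i))).
  by apply/funext => N; rewrite coef_qpochX.
have prod_cvg1 : \prod_(i < k) (1 - p ^+ (N - i)) @[N --> \oo] --> (1 : K).
  have factor_cvg1 (i : 'I_k) : 1 - p ^+ (N - i) @[N --> \oo] --> (1 - 0 : K).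
    apply: cvgB; first exact: cvg_cst.
    exact: cvg_comp (cvg_subnr i) cvg_p.
  have := @cvg_big K 'I_k *%R 1 xpredT (@mul_continuous K) nat \oo
    (index_enum 'I_k) _ _ _ (fun i _ => factor_cvg1 i).
  by rewrite subr0 big1 //; apply.
by have := cvgM (cvg_cst (euler_series c p k)) prod_cvg1; rewrite mulr1; apply.
Qed.

Lemma fps_qpoch_oo_linear {K : numFieldType} (c p : K) :
  `|p| < 1 -> p ^+ n @[n --> \oo] --> (0 : K) ->
  fps_qpoch_oo (c *: 'X) p = euler_series c p.
Proof.
move=> p1 cvg_p; apply/funext => k; apply: cvg_lim; first exact: norm_hausdorff.
exact: cvg_coef_qpochX.
Qed.

Lemma fps_qpoch_oo_square {K : numFieldType} (p : K) :
  `|p| < 1 -> p ^+ n @[n --> \oo] --> (0 : K) ->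
  fps_qpoch_oo 'X^2 p = fps_even (euler_series 1 p).
Proof.
move=> p1 cvg_p; apply/funext => n; apply: cvg_lim; first exact: norm_hausdorff.
have qpochE N : qpoch 'X^2 p%:P N = qpoch (1 *: 'X) p%:P N \Po 'X^2.
  rewrite scale1r /qpoch rmorph_prod; apply: eq_bigr => i _.
  by rewrite /= rmorphB rmorphM rmorphXn /= rmorph1 comp_polyX comp_polyC.
under eq_cvg do rewrite qpochE coef_comp_poly_Xn // dvdn2.
rewrite /fps_even; case: (odd n); first exact: cvg_cst.
by rewrite divn2; exact: cvg_coef_qpochX.
Qed.

(** * The connection formula *)

Lemma dqHermite_connection {K : numFieldType} (q a x y : K) (n : nat) :
  `|q| < 1 -> q ^+ m @[m --> \oo] --> (0 : K) -> a != 0 ->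
  dqHermite q n x y =
  (-1) ^+ n * \sum_(k < n.+1)
    qbinom q n k * dqHermite q k (x / a) 0 * (- a) ^+ k
    * pcoef q (n - k) y a.
Proof.
move=> q_lt1 cvg_q a_neq0.
have q_neq0 m := qpoch_neq0 m q_lt1.
have q2_lt1 : `|q ^+ 2| < 1 by rewrite normrX exprn_ilt1.
have cvg_q2 : (q ^+ 2) ^+ m @[m --> \oo] --> (0 : K).
  have -> : (fun m => (q ^+ 2) ^+ m) = (fun m => q ^+ m * q ^+ m).
    by apply/funext => m; rewrite -exprM mulnC exprM expr2.
  by have := cvgM cvg_q cvg_q; rewrite mulr0; apply.
(* T c and E c are (c t^2; q^2)_oo and (c t; q)_oo, and B is the quotient
   (t^2; q^2)_oo / (a^2 t^2; q^2)_oo. *)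
pose T c := fps_even (euler_series c (q ^+ 2)).
pose E c := euler_series c q.
pose B := fps_even (fps_dilate (a ^+ 2) (binomial_series (1 / a ^+ 2) (q ^+ 2))).
have E_neq0 c : E c 0%N != 0.
  by rewrite /E /euler_series qpoch0 invr1 !mulr1 oner_eq0.
have gfE u v : dqHermite_gf q u v =
    fps_mul (fps_mul (T 1) (E v)) (fps_inv (E u)).
  by rewrite /dqHermite_gf fps_qpoch_oo_square // !fps_qpoch_oo_linear.
have dilated : fps_dilate a (dqHermite_gf q (x / a) 0) =
    fps_mul (T (a ^+ 2)) (fps_inv (E x)).
  rewrite gfE fps_dilateM fps_dilateV // /E euler_series0 fps_mul1.
  rewrite fps_dilate_euler fps_dilate_even fps_dilate_euler.
  by rewrite mulr1 mulrCA divff ?mulr1.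
have TB : fps_mul (T (a ^+ 2)) B = T 1.
  rewrite /T /B -fps_evenM -{1}[a ^+ 2]mulr1.
  rewrite -fps_dilate_euler -fps_dilateM q_binomial.
    by rewrite fps_dilate_euler mulrCA divff ?mulr1 // expf_neq0.
  by move=> m; exact: qpoch_neq0.
have gf_split : dqHermite_gf q x y =
    fps_mul (fps_dilate a (dqHermite_gf q (x / a) 0)) (fps_mul B (E y)).
  rewrite dilated gfE -TB fps_mulA [fps_mul (fps_mul _ _) B]fps_mulC.
  rewrite fps_mulA [fps_mul B _]fps_mulC -!fps_mulA.
  by rewrite [fps_mul (fps_inv _) _]fps_mulC.
rewrite {1}/dqHermite gf_split mulr_sumr [RHS]mulr_sumr.
apply: eq_bigr => k _; have kn : (k <= n)%N by rewrite -ltnS.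
rewrite -pcoef_generating_function // /qbinom /dqHermite /fps_dilate.
have sgn_n : (-1) ^+ n = (-1) ^+ (n - k) * (-1) ^+ k :> K.
  by rewrite -exprD subnK.
have sgn2 : (-1) ^+ k * (-1) ^+ k = 1 :> K.
  by rewrite -exprD addnn -signr_odd odd_double.
rewrite sgn_n [(- a) ^+ k]exprNn -[LHS]mul1r -[X in X * _ = _]sgn2.
by field; rewrite !q_neq0.
Qed.

(** Convergence in R[i] is measured by positive elements of R[i] itself; these
    are real, so the statement reduces to the real sequence |p|^n. *)
Lemma cvg_complex_expr {R : realType} (K := R[i] : numFieldType) {p : K} :
  `|p| < 1 -> p ^+ n @[n --> \oo] --> (0 : K).
Proof.
move=> p1; apply/cvgr0Pnorm_lt => e e_gt0.
have eE : e = (complex.Re e)%:C%C by rewrite RRe_real // gtr0_real.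
have pE : `|p| = (complex.Re `|p|)%:C%C by rewrite RRe_real // normr_real.
have r_lt1 : `|complex.Re `|p| | < 1.
  rewrite ger0_norm; first by rewrite -ltcR -pE.
  by rewrite -lecR -pE normr_ge0.
have /cvgr0Pnorm_lt /(_ (complex.Re e)) := cvg_expr r_lt1.
rewrite -ltcR -eE => /(_ e_gt0); apply: filterS => n.
rewrite -ltcR -eE normrX normrX; apply: le_lt_trans.
by rewrite {1}pE -rmorphXn lecR lerXn2r ?nnegrE ?ler_norm // -lecR -pE normr_ge0.
Qed.

Theorem proposition6p1 (R : realType) (q a x y : R[i]) (n : nat)
    (q_gt0 : 0 < `|q|) (q_lt1 : `|q| < 1) (a_neq0 : a != 0) :
  dqHermite q n x y =
  (-1) ^+ n * \sum_(k < n.+1)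
    qbinom q n k * dqHermite q k (x / a) 0 * (- a) ^+ k
    * pcoef q (n - k) y a.
Proof.
exact: (@dqHermite_connection R[i] q a x y n q_lt1
  (cvg_complex_expr q_lt1) a_neq0).
Qed.
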